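(* Let $(M,h,\nabla)$ be a statistical manifold with $h$ a non-degenerate symmetric $(0,2)$-tensor field, and let $J:TM\to TM$ be an $h$-symmetric $(1,1)$-tensor field such that $\nabla J$ is $h$-symmetric. Let $$\hat J=\begin{pmatrix} J & (I-J^2)h^{-1}\\ h & -J^*\end{pmatrix}$$ be the generalized almost product structure on $TM\oplus T^*M$ induced by $(h,J)$. Then $$N_{\hat J}^{\nabla^{(\alpha)}}(X+\eta,Y+\beta)=N_{\hat J}^{\nabla}(X+\eta,Y+\beta)$$ for all vector fields $X,Y$, all $1$-forms $\eta,\beta$ and all $\alpha\in\mathbb{R}$. In particular, integrability of $\hat J$ is $\alpha$-invariant: for every $\alpha\in\mathbb{R}$, $N_{\hat J}^{\nabla^{(\alpha)}}=0$ if and only if $N_{\hat J}^{\nabla}=0$.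
   Context: The tensor $h$ is identified with the bundle isomorphism $h:TM\to T^*M$, $h(X)=h(X,\cdot)$, with inverse $h^{-1}$. $(M,h,\nabla)$ is a statistical manifold if $\nabla$ is a torsion-free affine connection and $(\nabla_Xh)(Y,Z)=(\nabla_Yh)(X,Z)$ for all $X,Y,Z$. $J$ is $h$-symmetric if $h(JX,Y)=h(X,JY)$; $\nabla J$ is $h$-symmetric if $h((\nabla_XJ)Y,Z)=h((\nabla_XJ)Z,Y)$ for all $X,Y,Z$; $(J^*\eta)(X)=\eta(JX)$. The matrix means $\hat J(X+\eta)=JX+(I-J^2)h^{-1}(\eta)+h(X)-J^*\eta$. The dual connection $\nabla^*$ is defined by $X(h(Y,Z))=h(\nabla_XY,Z)+h(Y,\nabla^*_XZ)$, and $\nabla^{(\alpha)}=\frac{1+\alpha}{2}\nabla+\frac{1-\alpha}{2}\nabla^*$. For an affine connection $D$ on $M$ (acting on $1$-forms by $(D_X\beta)(Y)=X(\beta(Y))-\beta(D_XY)$), the bracket is $[X+\eta,Y+\beta]_D=[X,Y]+D_X\beta-D_Y\eta$, and the Nijenhuis tensor of $\hat J$ with respect to $D$ is $N_{\hat J}^{D}(\sigma,\tau)=[\hat J\sigma,\hat J\tau]_D-\hat J[\hat J\sigma,\tau]_D-\hat J[\sigma,\hat J\tau]_D+\hat J^2[\sigma,\tau]_D$. $\hat J$ is integrable with respect to $[\cdot,\cdot]_D$ if $N_{\hat J}^D=0$. *)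

(* Defs.v *)
From HB Require Import structures.
From mathcomp Require Import all_boot all_order all_algebra.
From mathcomp Require Import all_classical all_reals all_analysis.
From mathcomp Require Import ring.
Set Implicit Arguments.
Unset Strict Implicit.
Unset Printing Implicit Defensive.
Import Order.TTheory GRing.Theory Num.Theory.
Import numFieldNormedType.Exports.
Local Open Scope classical_set_scope.
Local Open Scope ring_scope.

Section Smooth.
Variables (R : realType) (n : nat).
Implicit Types (U : set 'rV[R]_n) (f g : 'rV[R]_n -> R).

Definition partial (i : 'I_n) f : 'rV[R]_n -> R := 'D_(delta_mx 0 i) f.

(* All partial derivatives of order at most k exist and are continuous on U;
   used for open U only, as 'D looks at a whole neighbourhood of the point. *)
Fixpoint Ck_on (k : nat) U f : Prop :=
  {in U, continuous f} /\
  if k is k'.+1 then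
    forall i : 'I_n, (forall x, U x -> derivable f x (delta_mx 0 i)) /\
                     Ck_on k' U (partial i f)
  else True.

Definition smooth_on U f : Prop := forall k, Ck_on k U f.

Lemma Ck_onS k U f : Ck_on k.+1 U f -> Ck_on k U f.
Proof.
elim: k f => [|k IH] f; first by case=> cf _; split.
by case=> cf H; split=> // i; have [df Hi] := H i; split=> //; exact: IH.
Qed.

Lemma Ck_on_cst k U (c : R) : Ck_on k U (cst c).
Proof.
elim: k c => [|k IH] c; first by split=> // x _; exact: cst_continuous.
split=> [x _|i]; first exact: cst_continuous.
split=> [x _|]; first exact: derivable_cst.
suff -> : partial i (cst c) = cst 0 by exact: IH.
by apply/funext => x; rewrite /partial derive_cst.
Qed.

Lemma Ck_on_ext k U f g : open U -> (forall x, U x -> f x = g x) ->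
  Ck_on k U f -> Ck_on k U g.
Proof.
move=> oU.
have near_eq f' g' x : (forall y, U y -> f' y = g' y) -> U x ->
    {near x, f' =1 g'}.
  by move=> e Ux; near=> y; apply: e; near: y; exact: open_nbhs_nbhs.
have cont f' g' : (forall y, U y -> f' y = g' y) ->
    {in U, continuous f'} -> {in U, continuous g'}.
  move=> e cf x /[dup] xU /set_mem Ux.
  rewrite /continuous_at -(e _ Ux).
  exact: cvg_trans (near_eq_cvg (near_eq _ _ _ e Ux)) (cf x xU).
elim: k f g => [|k IH] f g e; first by case=> cf _; split=> //; exact: cont cf.
case=> cf H; split=> [|i]; first exact: cont cf.
have [df Hi] := H i; split=> [x Ux|].
  exact: near_eq_derivable (near_eq _ _ _ e Ux) (df x Ux).
apply: IH Hi => x Ux; rewrite /partial.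
exact: near_eq_derive (near_eq _ _ _ e Ux).
Unshelve. all: by end_near. Qed.

Lemma Ck_onB k U f g : open U ->
  Ck_on k U f -> Ck_on k U g -> Ck_on k U (f - g).
Proof.
move=> oU; elim: k f g => [|k IH] f g.
  by move=> [cf _] [cg _]; split=> // x xU; exact: (cvgB (cf x xU) (cg x xU)).
move=> [cf Hf] [cg Hg]; split=> [x xU|i].
  by exact: (cvgB (cf x xU) (cg x xU)).
have [df Hfi] := Hf i; have [dg Hgi] := Hg i; split=> [x Ux|].
  by apply: derivableB; [exact: df|exact: dg].
apply: (Ck_on_ext oU _ (IH _ _ Hfi Hgi)) => x Ux.
by rewrite /partial deriveB//; [exact: df|exact: dg].
Qed.

Lemma Ck_onD k U f g : open U ->
  Ck_on k U f -> Ck_on k U g -> Ck_on k U (f + g).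
Proof.
move=> oU Hf Hg; rewrite -[g]opprK -[- g]add0r.
by apply: Ck_onB => //; apply: Ck_onB => //; exact: Ck_on_cst.
Qed.

Lemma Ck_onM k U f g : open U ->
  Ck_on k U f -> Ck_on k U g -> Ck_on k U (f * g).
Proof.
move=> oU; elim: k f g => [|k IH] f g.
  by move=> [cf _] [cg _]; split=> // x xU; exact: (cvgM (cf x xU) (cg x xU)).
move=> /[dup] /Ck_onS Hf0 [cf Hf] /[dup] /Ck_onS Hg0 [cg Hg].
split=> [x xU|i].
  by exact: (cvgM (cf x xU) (cg x xU)).
have [df Hfi] := Hf i; have [dg Hgi] := Hg i; split=> [x Ux|].
  by apply: derivableM; [exact: df|exact: dg].
apply: (Ck_on_ext oU _ (Ck_onD oU (IH _ _ Hf0 Hgi) (IH _ _ Hg0 Hfi))) => x Ux.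
by rewrite /partial deriveM//; [exact: df|exact: dg].
Qed.

End Smooth.

(* The values of [fwd] outside [dom] and of [bwd] outside [cod] are
   irrelevant. *)
Record chart (R : realType) (n : nat) (M : topologicalType) := Chart {
  dom : set M;
  cod : set 'rV[R]_n;
  fwd : M -> 'rV[R]_n;
  bwd : 'rV[R]_n -> M;
  dom_open : open dom;
  cod_open : open cod;
  fwd_cod : forall p, dom p -> cod (fwd p);
  bwd_dom : forall x, cod x -> dom (bwd x);
  fwdK : forall p, dom p -> bwd (fwd p) = p;
  bwdK : forall x, cod x -> fwd (bwd x) = x;
  fwd_continuous : {in dom, continuous fwd};
  bwd_continuous : {in cod, continuous bwd} }.

Arguments dom_open {R n M} c.
Arguments cod_open {R n M} c.

Record manifold (R : realType) (n : nat) := Manifold {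
  carrier :> topologicalType;
  manifold_hausdorff : hausdorff_space carrier;
  manifold_second_countable : @second_countable carrier;
  atlas : set (chart R n carrier);
  atlas_cover : forall p, exists2 c, atlas c & dom c p;
  atlas_smooth : forall c d, atlas c -> atlas d -> forall j : 'I_n,
    smooth_on (cod c `&` bwd c @^-1` dom d)
              (fun x => fwd d (bwd c x) 0 j) }.

Section SmoothFunctions.
Variables (R : realType) (n : nat) (M : manifold R n).

Definition smooth (f : M -> R) : Prop :=
  forall c, atlas c -> smooth_on (cod c) (f \o bwd c).

Definition smooth_pred : {pred M -> R} := fun f => `[< smooth f >].

Lemma smooth_subring : subring_closed smooth_pred.
Proof.
split=> [|f g /asboolP sf /asboolP sg|f g /asboolP sf /asboolP sg];
  apply/asboolP => c ac k.
- exact: Ck_on_cst.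
- exact: (Ck_onB (cod_open c) (sf c ac k) (sg c ac k)).
- exact: (Ck_onM (cod_open c) (sf c ac k) (sg c ac k)).
Qed.
HB.instance Definition _ :=
  GRing.isSubringClosed.Build (M -> R) smooth_pred smooth_subring.

(* The ring C^oo(M). *)
Record smooth_fun := SmoothFun {
  sfun_val :> M -> R;
  sfun_smooth : sfun_val \in smooth_pred }.

HB.instance Definition _ := [isSub for sfun_val].
HB.instance Definition _ := [Choice of smooth_fun by <:].
HB.instance Definition _ :=
  GRing.SubChoice_isSubComPzRing.Build _ _ smooth_fun (subringClosedP smooth_pred).

Lemma cst_smooth (c : R) : cst c \in smooth_pred.
Proof. by apply/asboolP => d _ k; exact: Ck_on_cst. Qed.

Definition sfun_cst (c : R) : smooth_fun := SmoothFun (cst_smooth c).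
End SmoothFunctions.

Section Fields.
Variables (R : realType) (n : nat) (M : manifold R n).
Local Notation C := (smooth_fun M).

(* A vector field is a family of tangent vectors (X_p)_p, that is of
   derivations f |-> (X f) p at p, such that X f is smooth for all smooth f;
   equivalently X is an R-linear derivation of C^oo(M). *)
Definition is_derivation (X : C -> C^o) : Prop :=
  [/\ forall f g : C, X (f + g) = X f + X g,
      forall (c : R) (f : C), X (sfun_cst M c * f) = sfun_cst M c * X f &
      forall f g : C, X (f * g) = X f * g + f * X g].

Definition derivation_pred : {pred C -> C^o} := fun X => `[< is_derivation X >].

Lemma derivation_submod : submod_closed derivation_pred.
Proof.
split=> [|a X Y /asboolP[XD XZ XM] /asboolP[YD YZ YM]]; apply/asboolP.
  by split=> *; rewrite ?addr0 ?mulr0 ?mul0r ?addr0.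
split=> [f g|c f|f g]; rewrite !fctE.
- by rewrite XD YD scalerDr addrACA.
- by rewrite XZ YZ mulrDr /GRing.scale/= mulrCA.
- by rewrite XM YM /GRing.scale/=; ring.
Qed.
HB.instance Definition _ :=
  GRing.isSubmodClosed.Build C (C -> C^o) derivation_pred derivation_submod.

Record vector_field := VectorField {
  vf_val :> C -> C^o;
  vf_derivation : vf_val \in derivation_pred }.

HB.instance Definition _ := [isSub for vf_val].
HB.instance Definition _ := [Choice of vector_field by <:].
HB.instance Definition _ := [SubChoice_isSubLmodule of vector_field by <:].

Lemma lie_bracket_subproof (X Y : vector_field) :
  (fun f => X (Y f) - Y (X f) : C^o) \in derivation_pred.
Proof.
have /asboolP[XD XZ XM] := vf_derivation X.
have /asboolP[YD YZ YM] := vf_derivation Y.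
apply/asboolP; split=> [f g|c f|f g].
- by rewrite XD YD XD YD; ring.
- by rewrite XZ YZ XZ YZ; ring.
- by rewrite XM YM XD YD !XM !YM; ring.
Qed.

Definition lie_bracket (X Y : vector_field) : vector_field :=
  VectorField (lie_bracket_subproof X Y).

Definition is_linear_form (w : vector_field -> C^o) : Prop :=
  forall (f : C) (X Y : vector_field), w (f *: X + Y) = f *: w X + w Y.

Definition one_form_pred : {pred vector_field -> C^o} :=
  fun w => `[< is_linear_form w >].

Lemma one_form_submod : submod_closed one_form_pred.
Proof.
split=> [|a w z /asboolP wl /asboolP zl]; apply/asboolP => f X Y.
  by rewrite scaler0 addr0.
by rewrite !fctE wl zl /GRing.scale/=; ring.
Qed.
HB.instance Definition _ :=
  GRing.isSubmodClosed.Build C (vector_field -> C^o) one_form_pred one_form_submod.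

(* Sections of T^*M, as C^oo(M)-linear forms on vector fields. *)
Record one_form := OneForm {
  of_val :> vector_field -> C^o;
  of_linear : of_val \in one_form_pred }.

HB.instance Definition _ := [isSub for of_val].
HB.instance Definition _ := [Choice of one_form by <:].
HB.instance Definition _ := [SubChoice_isSubLmodule of one_form by <:].

End Fields.

Section Connections.
Variables (R : realType) (n : nat) (M : manifold R n).
Local Notation C := (smooth_fun M).
Local Notation VF := (vector_field M).
Local Notation Omega1 := (one_form M).

(* Bundle endomorphisms of TM, as C^oo(M)-linear maps on vector fields. *)
Definition tensor11 : Type := {linear VF -> VF}.

(* (0,2)-tensor fields, identified with bundle maps TM -> T^*M: such an h is
   C^oo(M)-bilinear in curried form, [h X] being the 1-form h(X, .) and
   [h X Y] the function h(X, Y). *)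
Definition tensor02 : Type := {linear VF -> Omega1}.

Definition tensor11_fun (J : tensor11) : VF -> VF := J.
Coercion tensor11_fun : tensor11 >-> Funclass.
Definition tensor02_fun (h : tensor02) : VF -> Omega1 := h.
Coercion tensor02_fun : tensor02 >-> Funclass.

Record connection := Connection {
  conn_val :> VF -> VF -> VF;
  conn_linearl : forall (f : C) (X X' Y : VF),
    conn_val (f *: X + X') Y = f *: conn_val X Y + conn_val X' Y;
  conn_addr : forall X Y Y' : VF,
    conn_val X (Y + Y') = conn_val X Y + conn_val X Y';
  conn_leibniz : forall (X : VF) (f : C) (Y : VF),
    conn_val X (f *: Y) = X f *: Y + f *: conn_val X Y }.

Definition torsion_free (D : connection) : Prop :=
  forall X Y : VF, D X Y - D Y X = lie_bracket X Y.

Definition symmetric_tensor (h : tensor02) : Prop :=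
  forall X Y : VF, h X Y = h Y X.

(* h_p(X_p, .) = 0 implies X_p = 0, at every point p; every tangent vector at
   p is the value at p of some vector field. *)
Definition nondegenerate_tensor (h : tensor02) : Prop :=
  forall (p : M) (X : VF),
    (forall Y : VF, (h X Y : C) p = 0) -> forall f : C, (X f : C) p = 0.

Definition cov_tensor02 (D : connection) (h : tensor02) (X Y Z : VF) : C :=
  X (h Y Z) - h (D X Y) Z - h Y (D X Z).

Definition cov_tensor11 (D : connection) (J : tensor11) (X Y : VF) : VF :=
  D X (J Y) - J (D X Y).

Definition statistical (h : tensor02) (D : connection) : Prop :=
  torsion_free D /\
  forall X Y Z : VF, cov_tensor02 D h X Y Z = cov_tensor02 D h Y X Z.

Definition h_symmetric (h : tensor02) (J : tensor11) : Prop :=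
  forall X Y : VF, h (J X) Y = h X (J Y).

Definition cov_h_symmetric (h : tensor02) (D : connection) (J : tensor11) :
    Prop :=
  forall X Y Z : VF,
    h (cov_tensor11 D J X Y) Z = h (cov_tensor11 D J X Z) Y.

Definition dual_connection (h : tensor02) (D Ds : connection) : Prop :=
  forall X Y Z : VF, X (h Y Z) = h (D X Y) Z + h Y (Ds X Z).

Section AlphaConnection.
Variables (D Ds : connection) (alpha : R).

Definition alpha_conn (X Y : VF) : VF :=
  sfun_cst M ((1 + alpha) / 2) *: D X Y
  + sfun_cst M ((1 - alpha) / 2) *: Ds X Y.

Lemma alpha_conn_linearl (f : C) (X X' Y : VF) :
  alpha_conn (f *: X + X') Y = f *: alpha_conn X Y + alpha_conn X' Y.
Proof.
rewrite /alpha_conn !conn_linearl !scalerDr !scalerA addrACA.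
by rewrite [_ * f]mulrC [_ * f]mulrC.
Qed.

Lemma alpha_conn_addr (X Y Y' : VF) :
  alpha_conn X (Y + Y') = alpha_conn X Y + alpha_conn X Y'.
Proof. by rewrite /alpha_conn !conn_addr !scalerDr addrACA. Qed.

Lemma alpha_conn_leibniz (X : VF) (f : C) (Y : VF) :
  alpha_conn X (f *: Y) = X f *: Y + f *: alpha_conn X Y.
Proof.
rewrite /alpha_conn !conn_leibniz !scalerDr !scalerA addrACA -scalerDl -mulrDl.
have -> : sfun_cst M ((1 + alpha) / 2) + sfun_cst M ((1 - alpha) / 2) = 1.
  apply/val_inj; rewrite rmorphD rmorph1; apply/funext => p.
  by change ((1 + alpha) / 2 + (1 - alpha) / 2 = 1); field.
by rewrite mul1r [_ * f]mulrC [_ * f]mulrC.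
Qed.

Definition alpha_connection : connection :=
  Connection alpha_conn_linearl alpha_conn_addr alpha_conn_leibniz.
End AlphaConnection.

Lemma cov_form_subproof (D : connection) (X : VF) (b : Omega1) :
  (fun Y => X (b Y) - b (D X Y) : C^o) \in @one_form_pred _ _ M.
Proof.
have /asboolP[XD _ XM] := vf_derivation X.
have /asboolP bl := of_linear b.
apply/asboolP => f Y Z.
by rewrite conn_addr conn_leibniz -addrA !bl XD XM /GRing.scale/=; ring.
Qed.

Definition cov_form (D : connection) (X : VF) (b : Omega1) : Omega1 :=
  OneForm (cov_form_subproof D X b).

Lemma pullback_subproof (J : tensor11) (b : Omega1) :
  (fun Y => b (J Y) : C^o) \in @one_form_pred _ _ M.
Proof.
have /asboolP bl := of_linear b.
by apply/asboolP => f Y Z; rewrite /tensor11_fun linearP bl.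
Qed.

Definition pullback (J : tensor11) (b : Omega1) : Omega1 :=
  OneForm (pullback_subproof J b).

(* Sections of TM (+) T^*M, with [(X, eta)] for X + eta. *)
Definition gen_field : Type := (VF * Omega1)%type.

Definition gen_bracket (D : connection) (s t : gen_field) : gen_field :=
  (lie_bracket s.1 t.1, cov_form D s.1 t.2 - cov_form D t.1 s.2).

(* The block matrix of the structure induced by (h, J), applied to a section;
   [hinv] has to be the two-sided inverse of [h]. *)
Definition gen_J (h : tensor02) (hinv : Omega1 -> VF) (J : tensor11)
    (s : gen_field) : gen_field :=
  (J s.1 + (hinv s.2 - J (J (hinv s.2))), h s.1 - pullback J s.2).

Definition nijenhuis (K : gen_field -> gen_field) (D : connection)
    (s t : gen_field) : VF * Omega1 :=
  gen_bracket D (K s) (K t) - K (gen_bracket D (K s) t)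
  - K (gen_bracket D s (K t)) + K (K (gen_bracket D s t)).

Definition gen_integrable (K : gen_field -> gen_field) (D : connection) : Prop :=
  forall s t : gen_field, nijenhuis K D s t = 0.

End Connections.

(* Main.v *)
(** Put S = nabla^(alpha) - nabla. By Codazzi and duality S is symmetric and
    h-self-adjoint, and differentiating h(JY, Z) = h(Y, JZ) shows that S
    commutes with J. Identify T^*M with TM through h. Then passing from nabla
    to nabla^(alpha) changes the bracket of (X, A) and (Y, B) by
    (0, S(A, Y) - S(X, B)), which is a determinant over the ring generated by J,
    while \hat J is the matrix ((J, 1 - J^2), (1, -J)), of trace 0, determinant
    -1 and square 1. Hence the change of the Nijenhuis tensor is
    det(\hat J) det - \hat J (tr(\hat J) det) + \hat J^2 det = 0. *)
Require Import Defs.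
From mathcomp Require Import all_boot all_order all_algebra.
From mathcomp Require Import all_classical all_reals all_analysis.
From mathcomp Require Import ring.
Import GRing.Theory Num.Theory.
Local Open Scope ring_scope.

(** * Evaluation and linearity of fields, forms and tensors *)

Section Evaluation.
Context {R : realType} {n : nat} {M : manifold R n}.
Local Notation C := (smooth_fun M).
Local Notation VF := (vector_field M).
Local Notation Omega1 := (one_form M).

Lemma one_form_ext (v w : Omega1) : (forall X, v X = w X) -> v = w.
Proof. by move=> vw; apply/val_inj/funext. Qed.

(** Reduces identities between vector fields to identities in C^oo(M), where [ring] applies. *)
Lemma vector_field_ext (X Y : VF) : (forall f, X f = Y f) -> X = Y.
Proof. by move=> XY; apply/val_inj/funext. Qed.

Lemma vector_fieldDE (X Y : VF) f : (X + Y) f = (X f : C) + (Y f : C).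
Proof. by []. Qed.

Lemma vector_fieldNE (X : VF) f : (- X) f = - (X f : C).
Proof. by []. Qed.

Lemma vector_field0E f : (0 : VF) f = (0 : C).
Proof. by []. Qed.

Definition vector_fieldE := (vector_fieldDE, vector_fieldNE, vector_field0E).

Lemma one_formDE (v w : Omega1) X : (v + w) X = v X + w X.
Proof. by []. Qed.

Lemma one_formNE (v : Omega1) X : (- v) X = - v X.
Proof. by []. Qed.

Lemma one_formD (w : Omega1) X Y : w (X + Y) = w X + w Y.
Proof. by have /asboolP wl := of_linear w; rewrite -[X]scale1r wl !scale1r. Qed.

Lemma one_formB (w : Omega1) X Y : w (X - Y) = w X - w Y.
Proof. by apply/eqP; rewrite -subr_eq opprK -one_formD subrK. Qed.

Lemma tensor02D (h : tensor02 M) X Y : h (X + Y) = h X + h Y.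
Proof. exact: linearD. Qed.

Lemma tensor02_0 (h : tensor02 M) : h 0 = 0.
Proof. exact: linear0. Qed.

Lemma tensor02B (h : tensor02 M) X Y : h (X - Y) = h X - h Y.
Proof. exact: linearB. Qed.

Lemma tensor02Z (h : tensor02 M) (f : C) X Y : h (f *: X) Y = f * h X Y.
Proof. by rewrite /tensor02_fun linearZ. Qed.

Lemma tensor11_0 (J : tensor11 M) : J 0 = 0.
Proof. exact: linear0. Qed.

Lemma tensor11D (J : tensor11 M) X Y : J (X + Y) = J X + J Y.
Proof. exact: linearD. Qed.

Lemma tensor11N (J : tensor11 M) X : J (- X) = - J X.
Proof. exact: linearN. Qed.

Definition tensor11E := (tensor11_0, tensor11D, tensor11N).

Lemma tensor11Z (J : tensor11 M) (f : C) X : J (f *: X) = f *: J X.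
Proof. exact: linearZ. Qed.

Lemma cov_formE (D : connection M) X (w : Omega1) Y :
  cov_form D X w Y = (X (w Y) : C) - (w (D X Y) : C).
Proof. by []. Qed.

End Evaluation.

(** * The difference of two connections and its symmetries *)

Definition conn_diff {R : realType} {n : nat} {M : manifold R n}
  (D E : connection M) (X Y : vector_field M) : vector_field M := E X Y - D X Y.

Definition conn_diff_sym {R : realType} {n : nat} {M : manifold R n}
    (D E : connection M) : Prop :=
  forall X Y, conn_diff D E X Y = conn_diff D E Y X.

Definition conn_diff_selfadjoint {R : realType} {n : nat} {M : manifold R n}
    (h : tensor02 M) (D E : connection M) : Prop :=
  forall X Y Z, h (conn_diff D E X Y) Z = h Y (conn_diff D E X Z).

Definition conn_diff_commute {R : realType} {n : nat} {M : manifold R n}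
    (J : tensor11 M) (D E : connection M) : Prop :=
  forall X Y, conn_diff D E X (J Y) = J (conn_diff D E X Y).

(** * Invariance of the Nijenhuis tensor under a change of connection *)

Section NijenhuisInvariance.
Context {R : realType} {n : nat} {M : manifold R n}.
Local Notation VF := (vector_field M).
Local Notation Omega1 := (one_form M).
Context {h : tensor02 M} {hinv : Omega1 -> VF} {J : tensor11 M}.
Hypotheses (hK : cancel h hinv) (hinvK : cancel hinv h).
Hypothesis J_sym : h_symmetric h J.
Local Notation Jhat := (gen_J h hinv J).

(** The h-symmetry of J makes J^* act as J once T^*M is identified with TM through [h]. *)
Lemma pullback_h X : pullback J (h X) = h (J X).
Proof. by apply: one_form_ext => Y; exact: esym (J_sym _ _). Qed.

Lemma gen_J_h X A : Jhat (X, h A) = (J X + (A - J (J A)), h (X - J A)).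
Proof. by rewrite /gen_J /= hK pullback_h tensor02B. Qed.

(** [hinv] is a bare map, so both forms are first written as values of [h], which is additive. *)
Lemma gen_JD s t : Jhat (s + t : VF * Omega1) = (Jhat s + Jhat t : VF * Omega1).
Proof.
case: s t => [X v] [Y w]; rewrite -(hinvK v) -(hinvK w).
rewrite -[LHS]/(Jhat (X + Y, h (hinv v) + h (hinv w))) -tensor02D !gen_J_h.
rewrite -[RHS]/(_ + _, h _ + h _) -tensor02D !tensor11E.
by congr (_, h _); apply: vector_field_ext => f; rewrite !vector_fieldE; ring.
Qed.

Lemma gen_J0 : Jhat 0 = 0 :> VF * Omega1.
Proof. by apply: (addrI (Jhat 0)); rewrite -gen_JD !addr0. Qed.

Lemma pair_hD A B : (0, h (A + B)) = (0, h A) + (0, h B) :> VF * Omega1.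
Proof. by rewrite -[RHS]/(0 + 0, h A + h B) addr0 tensor02D. Qed.

(** The off-diagonal block J(1 - J^2) - (1 - J^2)J vanishes and (1 - J^2) + J^2 = 1. Pairs (0, h A)
    suffice, since every change of a bracket has this form. *)
Lemma gen_J_invol A : Jhat (Jhat (0, h A)) = (0, h A).
Proof.
rewrite !gen_J_h !tensor11E.
by congr (_, h _); apply: vector_field_ext => f; rewrite !vector_fieldE; ring.
Qed.

Context {D E : connection M}.
Local Notation S := (conn_diff D E).
Hypotheses (S_sym : conn_diff_sym D E) (S_adj : conn_diff_selfadjoint h D E).
Hypothesis S_J : conn_diff_commute J D E.

(** The 2x2 determinant with columns (A, X) and (B, Y), for the product S. *)
Let delta X A Y B := S A Y - S X B.

Lemma conn_diffDr X Y Z : S X (Y + Z) = S X Y + S X Z.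
Proof. by rewrite /conn_diff !conn_addr opprD addrACA. Qed.

Lemma conn_diffNr X Y : S X (- Y) = - S X Y.
Proof.
have S0 : S X 0 = 0 by apply: (addrI (S X 0)); rewrite -conn_diffDr !addr0.
by apply/eqP; rewrite -addr_eq0 -conn_diffDr addNr S0.
Qed.

Lemma conn_diffDl X Y Z : S (X + Y) Z = S X Z + S Y Z.
Proof. by rewrite S_sym conn_diffDr !(S_sym Z). Qed.

Lemma conn_diffNl X Y : S (- X) Y = - S X Y.
Proof. by rewrite S_sym conn_diffNr (S_sym Y). Qed.

(** With [S_J], this lets J leave either argument, so determinants expand as over a commutative ring
    containing J. *)
Lemma conn_diffJl X Y : S (J X) Y = J (S X Y).
Proof. by rewrite S_sym S_J S_sym. Qed.

Definition conn_diffE :=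
  (conn_diffDr, conn_diffNr, conn_diffDl, conn_diffNl, S_J, conn_diffJl).

(** At Z, the forms E_X(h B) and D_X(h B) differ by -h(B, S(X, Z)), which is -h(S(X, B), Z) by
    self-adjointness. *)
Lemma gen_bracket_conn_diff X A Y B :
  gen_bracket E (X, h A) (Y, h B) =
  gen_bracket D (X, h A) (Y, h B) + (0, h (delta X A Y B)) :> VF * Omega1.
Proof.
rewrite -[RHS]/(_ + 0, _ + _) addr0; congr pair; apply: one_form_ext => Z.
rewrite tensor02B !one_formDE !one_formNE !cov_formE (S_sym A) !S_adj.
rewrite /conn_diff !one_formB; cbn [fst snd].
move: (h A (E Y Z)) (h A (D Y Z)) (h B (E X Z)) (h B (D X Z))
  (X (h B Z)) (Y (h A Z)).
by move=> *; ring.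
Qed.

Lemma nijenhuis_conn_diff s t : nijenhuis Jhat E s t = nijenhuis Jhat D s t.
Proof.
case: s t => [X v] [Y w]; rewrite -(hinvK v) -(hinvK w).
move: (hinv v) (hinv w) => A B; rewrite /nijenhuis.
rewrite !(gen_J_h X) !(gen_J_h Y) !gen_bracket_conn_diff !gen_JD gen_J_invol.
set d1 := delta _ _ _ _; set d2 := delta _ _ _ _.
set d3 := delta _ _ _ _; set d4 := delta _ _ _ _.
(* det(K s, K t) = det(K) det(s, t) with det(K) = -1. *)
have det_J : d1 = - d4.
  rewrite /d1 /d4 /delta !conn_diffE !tensor11E.
  by apply: vector_field_ext => f; rewrite !vector_fieldE; ring.
(* det(K s, t) + det(s, K t) = tr(K) det(s, t) with tr(K) = 0. *)
have tr_J : d2 = - d3.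
  rewrite /d2 /d3 /delta !conn_diffE !tensor11E.
  by apply: vector_field_ext => f; rewrite !vector_fieldE; ring.
have regroup (V : zmodType) (a b c d a' b' c' d' : V) :
    a + a' - (b + b') - (c + c') + (d + d') = a - b - c + d + (a' - b' - c' + d').
  by rewrite !opprD (addrACA a) (addrACA (a - b)) (addrACA (a - b - c)).
rewrite regroup -[RHS]addr0; congr (_ + _).
(* The two middle changes merge under \hat J into the trace term; the outer two cancel. *)
rewrite -(addrA (0, _)) -opprD -gen_JD -!pair_hD det_J tr_J addNr tensor02_0.
by rewrite gen_J0 oppr0 addr0 -pair_hD addNr tensor02_0.
Qed.

End NijenhuisInvariance.

(** * The difference tensors of the dual and the alpha-connections *)

Section DualConnection.
Context {R : realType} {n : nat} {M : manifold R n}.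
Context {h : tensor02 M} {hinv : one_form M -> vector_field M} {J : tensor11 M}.
Context {nabla nablas : connection M}.
Hypothesis h_sym : symmetric_tensor h.
Hypotheses (hK : cancel h hinv).
Hypothesis dual : dual_connection h nabla nablas.
Local Notation K := (conn_diff nabla nablas).

Lemma tensor02_inj X Y : (forall Z, h X Z = h Y Z) -> X = Y.
Proof. by move=> hXY; apply: (can_inj hK); exact: one_form_ext. Qed.

(** Duality turns nabla h into K, so symmetries of nabla h become symmetries of K. *)
Lemma cov_tensor02_dual X Y Z : cov_tensor02 nabla h X Y Z = h Y (K X Z).
Proof. by rewrite /cov_tensor02 dual one_formB [h _ _ + _]addrC addrK. Qed.

Lemma cov_tensor02_sym X Y Z :
  cov_tensor02 nabla h X Y Z = cov_tensor02 nabla h X Z Y.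
Proof. by rewrite /cov_tensor02 !(h_sym _ Z) (h_sym Y) addrAC. Qed.

Lemma conn_diff_dual_selfadjoint : conn_diff_selfadjoint h nabla nablas.
Proof.
by move=> X Y Z; rewrite h_sym -!cov_tensor02_dual cov_tensor02_sym.
Qed.

(** Self-adjointness moves K to the other side, where Codazzi exchanges X and Y. *)
Lemma conn_diff_dual_sym : statistical h nabla -> conn_diff_sym nabla nablas.
Proof.
case=> _ codazzi X Y; apply: tensor02_inj => Z.
by rewrite !conn_diff_dual_selfadjoint -!cov_tensor02_dual codazzi.
Qed.

(** Tested against Z, the claim becomes (nabla_X h)(JY, Z) = (nabla_X h)(Y, JZ). *)
Lemma conn_diff_dual_commute : h_symmetric h J -> cov_h_symmetric h nabla J ->
  conn_diff_commute J nabla nablas.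
Proof.
move=> J_sym nablaJ_sym X Y; apply: tensor02_inj => Z.
rewrite J_sym !conn_diff_dual_selfadjoint -!cov_tensor02_dual.
have /eqP := nablaJ_sym X Y Z.
rewrite /cov_tensor11 !tensor02B !one_formDE !one_formNE !J_sym.
(* The derivatives of h(JY, Z) and h(Y, JZ) along X agree; what remains is the h-symmetry of nabla_X
   J with its negative terms moved across. *)
rewrite /cov_tensor02 J_sym subr_eq addrAC -subr_eq opprK => /eqP e.
rewrite (h_sym (J Y)) (h_sym Y (nabla X _)) -!addrA -!opprD.
by rewrite e (addrC (h (nabla X (J Z)) Y)).
Qed.

Local Notation nabla_ alpha := (alpha_connection nabla nablas alpha).

(** The coefficients of the two connections sum to 1. The properties required of S are linear in S,
    so they pass from K to this multiple. *)
Lemma conn_diff_alphaE alpha X Y :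
  conn_diff nabla (nabla_ alpha) X Y =
  sfun_cst M ((1 - alpha) / 2) *: K X Y.
Proof.
rewrite /conn_diff /= /alpha_conn.
have -> : sfun_cst M ((1 + alpha) / 2) = 1 - sfun_cst M ((1 - alpha) / 2).
  apply/val_inj; rewrite rmorphB rmorph1; apply/funext => p.
  by change ((1 + alpha) / 2 = 1 - (1 - alpha) / 2); field.
by rewrite scalerBl scale1r scalerBr addrAC [_ - _ - _]addrAC subrr add0r addrC.
Qed.

Lemma conn_diff_alpha_sym alpha :
  conn_diff_sym nabla nablas -> conn_diff_sym nabla (nabla_ alpha).
Proof. by move=> K_sym X Y; rewrite !conn_diff_alphaE K_sym. Qed.

Lemma conn_diff_alpha_selfadjoint alpha :
  conn_diff_selfadjoint h nabla nablas ->
  conn_diff_selfadjoint h nabla (nabla_ alpha).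
Proof.
move=> K_adj X Y Z.
by rewrite !conn_diff_alphaE (h_sym Y) !tensor02Z K_adj (h_sym Y).
Qed.

Lemma conn_diff_alpha_commute alpha :
  conn_diff_commute J nabla nablas -> conn_diff_commute J nabla (nabla_ alpha).
Proof. by move=> K_J X Y; rewrite !conn_diff_alphaE K_J tensor11Z. Qed.

End DualConnection.

Theorem corollary4p10 (R : realType) (n : nat) (M : manifold R n)
    (h : tensor02 M) (hinv : one_form M -> vector_field M)
    (nabla nablas : connection M) (J : tensor11 M)
    (h_sym : symmetric_tensor h) (h_nondeg : nondegenerate_tensor h)
    (hK : cancel h hinv) (hinvK : cancel hinv h)
    (stat : statistical h nabla)
    (dual : dual_connection h nabla nablas)
    (J_sym : h_symmetric h J)
    (nablaJ_sym : cov_h_symmetric h nabla J) :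
  (forall (alpha : R) (X Y : vector_field M) (eta beta : one_form M),
     nijenhuis (gen_J h hinv J) (alpha_connection nabla nablas alpha)
       (X, eta) (Y, beta) =
     nijenhuis (gen_J h hinv J) nabla (X, eta) (Y, beta)) /\
  (forall alpha : R,
     gen_integrable (gen_J h hinv J) (alpha_connection nabla nablas alpha) <->
     gen_integrable (gen_J h hinv J) nabla).
Proof.
have N_eq alpha s t :
    nijenhuis (gen_J h hinv J) (alpha_connection nabla nablas alpha) s t =
    nijenhuis (gen_J h hinv J) nabla s t.
  (* Symmetry, self-adjointness and commutation with J remain, each obtained for K and then
     scaled. *)
  apply: nijenhuis_conn_diff => //.
  - exact/conn_diff_alpha_sym/(conn_diff_dual_sym h_sym hK dual stat).
  - exact/(conn_diff_alpha_selfadjoint h_sym)/conn_diff_dual_selfadjoint.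
  - exact/conn_diff_alpha_commute/(conn_diff_dual_commute h_sym hK dual).
split=> [alpha X Y eta beta|alpha]; first exact: N_eq.
by split=> N0 s t; rewrite -[RHS](N0 s t) N_eq.
Qed.
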